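(* Let $\lambda$ be an infinite cardinal, $\kappa\le\lambda^+$ an infinite cardinal, $\tau_0$ a vocabulary with $|\tau_0|\le\lambda$ and $\psi\in\mathbb L_{\lambda^+,\kappa}(\tau_0)$ a sentence. Let $\Upsilon=\kappa$ if $\kappa\le\lambda$ and $\Upsilon=\kappa+1$ if $\kappa=\lambda^+$. Then there are a vocabulary $\tau_1\supseteq\tau_0$ of cardinality $\lambda$, a sequence $\bar F=\langle F_i:i<\Upsilon\rangle$ of pairwise distinct unary function symbols in $\tau_1\setminus\tau_0$, a sequence $\bar P=\langle P_i:i<\Upsilon\rangle$ of pairwise distinct unary predicate symbols in $\tau_1\setminus\tau_0$, a first-order $\tau_1$-theory $T_1$, a unary predicate $P_*\in\tau_1$, individual constants $c_i\in\tau_1$ ($i<\lambda$), and the (quantifier-free) type $p(x)=\{P_*(x)\wedge x\ne c_i:i<\lambda\}$, such that for every $\tau_0$-model $M_0$ the following are equivalent: (a) $M_0\models\psi$ and $\|M_0\|=\|M_0\|^{<\kappa}+\lambda$; (b) there is a $\tau_1$-expansion $M_1$ of $M_0$ which is a model of $T_1$ omitting $p(x)$ such that ($\alpha$) $\langle P_i^{M_1}:i<\Upsilon\rangle$ is a partition of the universe of $M_1$, and ($\beta$) whenever $i<\Upsilon$ and $a_j\in M_1$ for $j<i$, there is $b\in P_i^{M_1}$ with $F_j^{M_1}(b)=a_j$ for all $j<i$.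
   Context: $\mathbb L_{\lambda^+,\kappa}(\tau)$ is the set of infinitary $\tau$-formulas obtained from atomic formulas by negation, conjunctions of at most $\lambda$ formulas, and existential quantification over blocks of fewer than $\kappa$ variables, every formula having fewer than $\kappa$ free variables.
   Formalization: For κ=λ⁺ the formal theorem takes Υ=λ+1 instead of κ+1, since κ+1 would require λ⁺ pairwise distinct symbols F_i in a vocabulary τ₁ of cardinality λ, which is impossible; the case κ≤λ is as stated. *)

(* Defs.v *)
From mathcomp Require Import all_boot.
From mathcomp Require Import boolp classical_sets functions cardinality wochoice.

Set Implicit Arguments.
Unset Strict Implicit.
Unset Printing Implicit Defensive.

Local Open Scope classical_set_scope.
Local Open Scope card_scope.

Notation "A '#<' B" := (~~ (card_le B A))
  (at level 79, only parsing) : card_scope.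

(** * Ordinals and cardinals *)

(* An ordinal is represented by a well-ordered type, whose elements play the
   role of the smaller ordinals. *)
Record ord : Type := Ord {
  ord_car :> Type;
  ole : rel ord_car;
  ole_wo : well_order ole }.

Definition olt (o : ord) (x y : o) : bool := ~~ ole y x.

Definition below (o : ord) (i : o) : Type := {j : o | olt j i}.

Definition osucc_le (o : ord) (x y : option o) : bool :=
  match x, y with
  | _, None => true
  | None, Some _ => false
  | Some a, Some b => ole a b
  end.

Lemma osucc_wo (o : ord) : well_order (@osucc_le o).
Proof.
have anti (x y : o) : ole x y -> ole y x -> x = y.
  move=> xy yx; have [|z [[zA zl] zu]] := @ole_wo o (fun t => `[< t = x \/ t = y >]).
    by exists x; apply/asboolP; left.
  have refl (t : o) : ole t t.
    have [|u [[uA ul] _]] := @ole_wo o (fun s => `[< s = t >]).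
      by exists t; apply/asboolP.
    by have /asboolP uE := uA; subst u; apply: ul.
  have zx : z = x.
    apply: zu; split; first by apply/asboolP; left.
    by move=> t /asboolP[->|->].
  have zy : z = y.
    apply: zu; split; first by apply/asboolP; right.
    by move=> t /asboolP[->|->].
  by rewrite -zx -zy.
apply: antisymmetric_well_order.
  by move=> [x|] [y|] //= /andP[xy yx]; rewrite (anti x y).
move=> A [x0 Ax0].
have [[a Aa]|nA] := pselect (exists a, Some a \in A); last first.
  have AN : None \in A by case: x0 Ax0 => // a Aa; case: nA; exists a.
  exists None; split=> // -[a|] // Aa.
  by case: nA; exists a.
have [|z [[zA zl] _]] := @ole_wo o (fun t => Some t \in A); first by exists a.
by exists (Some z); split=> // -[b|] // Ab; apply: zl.
Qed.

Definition osucc (o : ord) : ord := Ord (@osucc_wo o).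

(* Cardinals are initial ordinals. *)
Definition is_cardinal (o : ord) : Prop :=
  forall i : o, [set: below i] #< [set: o].

Definition infinite_cardinal (o : ord) : Prop :=
  is_cardinal o /\ infinite_set [set: o].

Definition is_successor_cardinal (lam lamp : ord) : Prop :=
  [/\ is_cardinal lamp, [set: lam] #< [set: lamp] &
      forall mu : ord, is_cardinal mu -> [set: lam] #< [set: mu] ->
        [set: lamp] #<= [set: mu]].

(* [A]^{<kap} is the cardinality of the set of sequences of length < kap. *)
Definition seq_lt (kap : ord) (A : Type) : Type := {i : kap & below i -> A}.

(* For kap = lam^+ the ordinal has to be lam + 1: it indexes pairwise distinct
   symbols of a vocabulary of cardinality lam, so it cannot be lam^+ + 1, and
   every length < lam^+ has the cardinality of some ordinal < lam + 1. *)
Definition Upsilon (lam kap : ord) : ord :=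
  if [set: kap] #<= [set: lam] then kap else osucc lam.

(** * Vocabularies and structures *)

(* Symbols are sorted by arity; individual constants are the function symbols
   of arity 0. *)
Record vocab : Type := Vocab {
  fsymb : nat -> Type;
  rsymb : nat -> Type }.

Definition symbols (tau : vocab) : Type :=
  ({n : nat & fsymb tau n} + {n : nat & rsymb tau n})%type.

Record vocab_incl (tau0 tau1 : vocab) : Type := VocabIncl {
  finc : forall n, fsymb tau0 n -> fsymb tau1 n;
  rinc : forall n, rsymb tau0 n -> rsymb tau1 n;
  finc_inj : forall n, injective (@finc n);
  rinc_inj : forall n, injective (@rinc n) }.

Record structure (tau : vocab) : Type := Structure {
  univ :> Type;
  univ_inh : inhabited univ;
  fint : forall n, fsymb tau n -> n.-tuple univ -> univ;
  rint : forall n, rsymb tau n -> n.-tuple univ -> Prop }.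

Definition reduct tau0 tau1 (inc : vocab_incl tau0 tau1) (M : structure tau1) :
    structure tau0 :=
  @Structure tau0 M (univ_inh M) (fun n f => fint (finc inc f))
    (fun n r => rint (rinc inc r)).

Definition is_expansion tau0 tau1 (inc : vocab_incl tau0 tau1)
    (M0 : structure tau0) (M1 : structure tau1) : Prop :=
  reduct inc M1 = M0.

(** * Terms and atomic formulas, with variables in [V] *)

Inductive term (tau : vocab) (V : Type) : Type :=
| Var of V
| App n of fsymb tau n & ('I_n -> term tau V).

Arguments Var {tau V} _.
Arguments App {tau V n} _ _.

Fixpoint tvars tau V (t : term tau V) : set V :=
  match t with
  | Var v => [set v]
  | App n _ ts => \bigcup_(i in [set: 'I_n]) tvars (ts i)
  end.

Fixpoint eval tau V (M : structure tau) (s : V -> M) (t : term tau V) : M :=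
  match t with
  | Var v => s v
  | App n f ts => fint f [tuple eval s (ts i) | i < n]
  end.

Inductive atom (tau : vocab) (V : Type) : Type :=
| Equal of term tau V & term tau V
| Rel n of rsymb tau n & ('I_n -> term tau V).

Arguments Equal {tau V} _ _.
Arguments Rel {tau V n} _ _.

Definition avars tau V (a : atom tau V) : set V :=
  match a with
  | Equal t u => tvars t `|` tvars u
  | Rel n _ ts => \bigcup_(i in [set: 'I_n]) tvars (ts i)
  end.

Definition atom_holds tau V (M : structure tau) (s : V -> M) (a : atom tau V) :
    Prop :=
  match a with
  | Equal t u => eval s t = eval s u
  | Rel n r ts => rint r [tuple eval s (ts i) | i < n]
  end.

(** * Infinitary logic *)

Inductive formula (tau : vocab) (V : Type) : Type :=
| Atom of atom tau V
| Neg of formula tau V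
| Conj (J : Type) of (J -> formula tau V)
| Exists of set V & formula tau V.

Fixpoint fvars tau V (phi : formula tau V) : set V :=
  match phi with
  | Atom a => avars a
  | Neg psi => fvars psi
  | Conj J psis => \bigcup_(i in [set: J]) fvars (psis i)
  | Exists X psi => fvars psi `\` X
  end.

Fixpoint holds tau V (M : structure tau) (s : V -> M) (phi : formula tau V) :
    Prop :=
  match phi with
  | Atom a => atom_holds s a
  | Neg psi => ~ holds s psi
  | Conj J psis => forall i : J, holds s (psis i)
  | Exists X psi =>
      exists s' : V -> M, (forall v, ~ X v -> s' v = s v) /\ holds s' psi
  end.

(* The formulas of L_{lam^+,kap}; the bound on the number of free variables is
   imposed on all subformulas. *)
Fixpoint in_L (lam kap : ord) tau V (phi : formula tau V) : Prop :=
  fvars phi #< [set: kap] /\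
  match phi with
  | Atom _ => True
  | Neg psi => in_L lam kap psi
  | Conj J psis =>
      [set: J] #<= [set: lam] /\ forall i : J, in_L lam kap (psis i)
  | Exists X psi => X #< [set: kap] /\ in_L lam kap psi
  end.

Definition sentence_of_L (lam kap : ord) tau V (psi : formula tau V) : Prop :=
  in_L lam kap psi /\ fvars psi = set0.

Definition models tau V (M : structure tau) (psi : formula tau V) : Prop :=
  forall s : V -> M, holds s psi.

(** * First-order logic *)

Inductive fo (tau : vocab) : Type :=
| FOAtom of atom tau nat
| FONeg of fo tau
| FOAnd of fo tau & fo tau
| FOExists of nat & fo tau.

Fixpoint fo_fvars tau (phi : fo tau) : set nat :=
  match phi with
  | FOAtom a => avars a
  | FONeg psi => fo_fvars psi
  | FOAnd psi chi => fo_fvars psi `|` fo_fvars chi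
  | FOExists x psi => fo_fvars psi `\ x
  end.

Fixpoint fo_holds tau (M : structure tau) (s : nat -> M) (phi : fo tau) :
    Prop :=
  match phi with
  | FOAtom a => atom_holds s a
  | FONeg psi => ~ fo_holds s psi
  | FOAnd psi chi => fo_holds s psi /\ fo_holds s chi
  | FOExists x psi =>
      exists s' : nat -> M, (forall v, v <> x -> s' v = s v) /\ fo_holds s' psi
  end.

Definition fo_theory tau (T : set (fo tau)) : Prop :=
  forall phi, T phi -> fo_fvars phi = set0.

Definition fo_models tau (M : structure tau) (T : set (fo tau)) : Prop :=
  forall phi, T phi -> forall s : nat -> M, fo_holds s phi.

(* A type in one variable is a set of formulas whose only free variable is the
   variable 0. *)
Definition realizes tau (M : structure tau) (p : set (fo tau)) (a : M) : Prop :=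
  forall phi, p phi -> fo_holds (fun _ : nat => a) phi.

Definition omits tau (M : structure tau) (p : set (fo tau)) : Prop :=
  ~ exists a : M, realizes p a.

(* { P_*(x) /\ x <> c_i : i < lam } *)
Definition ptype tau (lam : ord) (Pstar : rsymb tau 1) (c : lam -> fsymb tau 0) :
    set (fo tau) :=
  [set FOAnd (FOAtom (Rel Pstar (fun _ => Var 0)))
         (FONeg (FOAtom (Equal (Var 0) (App (c i) (fun _ => Var 0)))))
  | i in [set: lam]].

(* Main.v *)
Require Import Defs.
From mathcomp Require Import all_boot.
From mathcomp Require Import boolp classical_sets functions cardinality wochoice.

(** The elements of [P_i] code the sequences of length [i], the [j]-th entry of
    [b] being [F_j b]; by (beta) every assignment of the fewer than [kap] free
    variables of a subformula of [psi] is coded.  There are at most [lam]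
    subformulas (finite paths in a [lam]-branching tree), and each gets a unary
    predicate [Sat] for the codes of its satisfying assignments.  Skolem functions
    make Tarski's truth conditions first-order.  [Recode] turns a code for a formula
    into a code for an immediate subformula, one axiom per variable.  The infinitary
    conditions "some conjunct fails" and "two assignments differ" are witnessed by
    functions with values in [P_*], that is, among the [c_i] when [p] is omitted.
    [T_1] is the set of all sentences true in every intended expansion.  On the
    cardinal side, (beta) says that the sequences of length [< Upsilon] inject into
    the universe, which, as [lam <= ||M||], amounts to the cardinal equation in (a). *)

Set Implicit Arguments.
Unset Strict Implicit.
Unset Printing Implicit Defensive.

Local Open Scope classical_set_scope.
Local Open Scope card_scope.

(** * Cardinal inequalities as injections between types *)

Definition emb (A B : Type) : Prop := exists f : A -> B, injective f.

Lemma emb_cardP (A B : Type) : reflect (emb A B) ([set: A] #<= [set: B]).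
Proof.
apply: (iffP idP) => [|[f finj]]; last first.
  by have /injfunPex[g] : exists2 f : A -> B, set_fun setT setT f & set_inj setT f
    by [exists f => // x y _ _; apply: finj]; apply: inj_card_le.
move=> /card_leP/injfunPex[f _ finj].
exists (fun x => set_val (f (SigSub (mem_set (I : [set: A] x))))) => x y.
by move=> /val_inj/(finj _ _ (in_setT _) (in_setT _))/(congr1 val).
Qed.

Lemma emb_set_rP (T B : Type) (A : set T) :
  reflect (emb B A) ([set: B] #<= A).
Proof.
by rewrite -(card_le_eqr (card_setT A)); apply: emb_cardP.
Qed.

Lemma emb_refl A : emb A A.
Proof. by exists id. Qed.

Lemma emb_trans B A C : emb A B -> emb B C -> emb A C.
Proof. by move=> [f fi] [g gi]; exists (g \o f); apply: inj_comp. Qed.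

Lemma emb_prod A B A' B' : emb A A' -> emb B B' -> emb (A * B) (A' * B').
Proof.
move=> [f fi] [g gi]; exists (fun x => (f x.1, g x.2)) => -[a b] [a' b'] [].
by move=> /fi -> /gi ->.
Qed.

Lemma emb_sum A B A' B' : emb A A' -> emb B B' -> emb (A + B) (A' + B').
Proof.
move=> [f fi] [g gi].
exists (fun x => match x with inl a => inl (f a) | inr b => inr (g b) end).
by move=> [a|b] [a'|b'] // [] => [/fi|/gi] ->.
Qed.

Lemma emb_surj A B (f : A -> B) : (forall b, exists a, f a = b) -> emb B A.
Proof. by move=> /choice[g gK]; exists g; apply: can_inj gK. Qed.

Lemma emb_surj_inv A B : emb A B -> inhabited A ->
  exists f : B -> A, forall a, exists b, f b = a.
Proof.
move=> [f fi] [a0].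
have /choice[g gP] : forall b, exists a, forall a', f a' = b -> a' = a.
  move=> b; have [[a <-]|nb] := pselect (exists a, f a = b).
    by exists a => a' /fi.
  by exists a0 => a' ab; case: nb; exists a'.
by exists g => a; exists (f a); rewrite -(gP _ _ erefl).
Qed.

(** A function on [A] is carried to the image of the injection and extended by the constant [m0]
    elsewhere. *)
Lemma emb_fun A B M : inhabited M -> emb A B -> emb (A -> M) (B -> M).
Proof.
move=> [m0] [f fi].
have /choice[g gP] : forall b, exists o : option A,
    forall a, f a = b -> o = Some a.
  move=> b; have [[a <-]|nb] := pselect (exists a, f a = b).
    by exists (Some a) => a' /fi ->.
  by exists None => a' ab; case: nb; exists a'.
exists (fun h b => if g b is Some a then h a else m0) => h h' hh'.
by apply/funext => a; have := congr1 (@^~ (f a)) hh'; rewrite (gP _ _ erefl).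
Qed.

Lemma emb_sig T (P Q : T -> Prop) :
  (forall x, P x -> Q x) -> emb {x | P x} {x | Q x}.
Proof.
move=> PQ; exists (fun x => exist Q (sval x) (PQ _ (svalP x))) => -[x Px] [y Py] /=.
move=> /(congr1 (@sval _ _)) /= xy; subst y.
by rewrite (Prop_irrelevance Px Py).
Qed.

Lemma emb_natP T : emb nat T <-> infinite_set [set: T].
Proof. by split=> [/emb_cardP/infiniteP|/infiniteP/emb_cardP]. Qed.

(* Transfinite recursion: at each stage some value of [X] is still unused. *)
Lemma emb_wf (W X : Type) (R : W -> W -> Prop) :
    well_founded R -> (forall x y, x <> y -> R x y \/ R y x) ->
    (forall w, ~ emb X {v | R v w}) ->
  emb W X.
Proof.
move=> wfR triR noX.
have [[w0]|nW] := pselect (inhabited W); last first.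
  by exists (fun w => False_rect _ (nW (inhabits w))) => w; case: nW.
have [[x0]|nX] := pselect (inhabited X); last first.
  case: (noX w0); exists (fun x => False_rect _ (nX (inhabits x))) => x.
  by case: nX.
(* If [rec] took every value, a section of it would embed [X] into the segment below [w]. *)
have stepP w (rec : {v | R v w} -> X) : exists x, forall v, rec v <> x.
  apply: contrapT => nx; apply: (noX w); apply: (@emb_surj _ _ rec) => x.
  apply: contrapT => nv; apply: nx; exists x => v vx.
  by apply: nv; exists v.
pose step w (rec : forall v, R v w -> X) : X :=
  projT1 (cid (stepP w (fun v => rec (sval v) (svalP v)))).
pose f := Fix wfR (fun=> X) step.
have fE w : f w = step w (fun v _ => f v).
  apply: Fix_eq => w' g g' gg'; congr (step w' _).
  by apply: functional_extensionality_dep => v; apply/funext => vw.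
have fN v w : R v w -> f v <> f w.
  move=> vw; rewrite (fE w) /step; case: cid => x /= xP.
  exact: (xP (exist _ v vw)).
exists f => v w vw; apply: contrapT => /triR[/fN|/fN]; first exact.
by apply.
Qed.

(** * Order properties of ordinals *)

Section OrdinalOrder.
Variable o : ord.
Implicit Types x y z : o.

Lemma ole_min (P : o -> Prop) : (exists x, P x) ->
  exists2 x, P x & forall y, P y -> ole x y.
Proof.
move=> [x Px]; have [|z [[/asboolP Pz zl] _]] := @ole_wo o (fun t => `[< P t >]).
  by exists x; apply/asboolP.
by exists z => // y Py; apply: zl; apply/asboolP.
Qed.

Lemma ole_refl x : ole x x.
Proof.
by have [|_ -> xl] := @ole_min (eq^~ x); [exists x|exact: xl].
Qed.

Lemma ole_total x y : ole x y || ole y x.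
Proof.
have [|_ [->|->] zl] := @ole_min (fun t => t = x \/ t = y).
- by exists x; left.
- by rewrite zl//; right.
- by rewrite orbC zl//; left.
Qed.

(** Both [x] and [y] are minima of the pair, and a well order has unique minima. *)
Lemma ole_anti x y : ole x y -> ole y x -> x = y.
Proof.
move=> xy yx.
have [|z [_ zu]] := @ole_wo o (fun t => `[< t = x \/ t = y >]).
  by exists x; apply/asboolP; left.
have <- : z = x.
  apply: zu; split; first by apply/asboolP; left.
  by move=> t /asboolP[->|->] //; exact: ole_refl.
apply: zu; split; first by apply/asboolP; right.
by move=> t /asboolP[->|->] //; exact: ole_refl.
Qed.

Lemma ole_trans y x z : ole x y -> ole y z -> ole x z.
Proof.
move=> xy yz; have [|t tP tl] := @ole_min (fun t => t = x \/ t = y \/ t = z).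
  by exists x; left.
case: tP => [tE|[tE|tE]]; subst t; first by apply: tl; right; right.
  by rewrite (ole_anti xy (tl _ (or_introl erefl))).
by rewrite -(ole_anti yz (tl _ (or_intror (or_introl erefl)))).
Qed.

Lemma oltW x y : olt x y -> ole x y.
Proof. by rewrite /olt; case/orP: (ole_total x y) => [//|->]. Qed.

Lemma olt_trans y x z : olt x y -> olt y z -> olt x z.
Proof. by move=> xy yz; apply: contra xy => zx; apply: ole_trans zx; apply: oltW. Qed.

Lemma olt_neq x y : x <> y -> olt x y \/ olt y x.
Proof.
rewrite /olt => xy; have [yx|] := boolP (ole y x); last by left.
by right; apply/negP => /ole_anti; apply: contra_not xy => ->.
Qed.

Lemma olt_wf : well_founded (fun x y => olt x y).
Proof.
move=> x; apply: contrapT => nx.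
have [|z nz zl] := @ole_min (fun t => ~ Acc (fun x y : o => olt x y) t).
  by exists x.
by apply: nz; constructor=> y /negP yz; apply: contrapT => /zl.
Qed.

End OrdinalOrder.

(** Applied contrapositively: a type that does not receive [o] embeds into a proper initial segment
    of [o]. *)
Lemma emb_ord (o : ord) (X : Type) :
  (forall i : o, ~ emb X (below i)) -> emb o X.
Proof. exact: (emb_wf (@olt_wf o) (@olt_neq o)). Qed.

(** * Initial segments and squares of infinite types *)

Lemma well_orderable (T : Type) : exists r : rel T, well_order r.
Proof. by have [r rwo] := well_ordering_principle {classic T}; exists r. Qed.

(** Together with [emb_None_below], this makes a well-ordered type an initial segment up to mutual
    embedding, so that [emb_square_below] covers whole types. *)
Lemma below_None (o : ord) : emb o (@below (osucc o) None).
Proof.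
by exists (fun x => exist (fun y : osucc o => olt y None) (Some x) isT) => x y [].
Qed.

Lemma below_val_inj (o : ord) (i : o) : injective (sval : below i -> o).
Proof.
by move=> [x xi] [y yi] /= xy; subst y; congr exist; apply: bool_irrelevance.
Qed.

Lemma emb_None_below (o : ord) : emb (@below (osucc o) None) o.
Proof.
have /choice[f fP] (x : @below (osucc o) None) : exists y, sval x = Some y.
  by case: x => [[y|] //= _]; exists y.
by exists f => x y fxy; apply: below_val_inj; rewrite !fP fxy.
Qed.

(** Hilbert's hotel along [f]: each [f n] moves to [f n.+1], which frees [f 0] for [None]. *)
Lemma emb_option T : emb nat T -> emb (option T) T.
Proof.
move=> [f fi].
exists (fun x => match x with
  | None => f 0
  | Some x => if pselect (exists n, f n = x) is left h
              then f (projT1 (cid h)).+1 else x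
  end).
have NS x : f 0 <> (if pselect (exists n, f n = x) is left h
                    then f (projT1 (cid h)).+1 else x).
  case: pselect => [h /fi //|nx fx]; by case: nx; exists 0.
move=> [x|] [y|] //; [|by move=> /esym/NS|by move=> /NS].
case: pselect => [h|nx]; case: pselect => [h'|ny].
- by case: cid => n /= <-; case: cid => m /= <- /fi[->].
- by move=> fy; case: ny; eexists; exact: fy.
- by move=> fx; case: nx; eexists; exact: esym fx.
- by move=> ->.
Qed.

Lemma finite_setT_prod A B : finite_set [set: A] -> finite_set [set: B] ->
  finite_set [set: A * B].
Proof. by rewrite -setXTT; apply: finite_setX. Qed.

Lemma finite_setT_option A : finite_set [set: A] -> finite_set [set: option A].
Proof.
move=> fA; have -> : [set: option A] = Some @` [set: A] `|` [set None].
  by apply/seteqP; split=> // -[a|] _; [left; exists a|right].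
by rewrite finite_setU; split; [apply: finite_image|apply: finite_set1].
Qed.

Lemma emb_ole (o : ord) (m : o) : emb {j : o | ole j m} (option (below m)).
Proof.
exists (fun j => if pselect (olt (sval j) m) is left h
                 then Some (exist (fun j => olt j m) (sval j) h) else None).
move=> [x xm] [y ym] /=.
have xE : x = y -> exist (fun j : o => ole j m) x xm = exist _ y ym.
  by move=> xy; subst y; congr exist; apply: bool_irrelevance.
case: pselect => [h|nh]; case: pselect => [h'|nh'] //; first by case=> /xE.
move=> _; apply: xE; transitivity m.
  by apply: ole_anti => //; apply: contrapT => /negP.
by apply/esym/ole_anti => //; apply: contrapT => /negP.
Qed.

(* Pairs are ordered by their maximum, ties being broken arbitrarily: a proper
   initial segment then lies in a square over a shorter ordinal. *)
Lemma emb_square_below (o : ord) (i : o) :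
  emb nat (below i) -> emb (below i * below i) (below i).
Proof.
elim/(well_founded_ind (@olt_wf o)): i => i IH infi.
(* A shorter segment that receives [below i] is settled by induction; afterwards there is none. *)
have [[j ji ij]|noj] := pselect (exists2 j, olt j i & emb (below i) (below j)).
  apply: (emb_trans (emb_prod ij ij)).
  apply: emb_trans (IH j ji (emb_trans infi ij)) _.
  by apply: emb_sig => x xj; apply: olt_trans ji.
have [r rwo] := well_orderable (below i * below i).
pose W := Ord rwo.
pose rho (w : below i * below i) : o :=
  if ole (sval w.1) (sval w.2) then sval w.2 else sval w.1.
pose R (v w : below i * below i) :=
  olt (rho v) (rho w) \/ rho v = rho w /\ @olt W v w.
have rho_lt w : olt (rho w) i by rewrite /rho; case: ifP => _; [case: w.2|case: w.1].
apply: (@emb_wf _ _ R).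
- suff H (t : o) (w : W) : rho w = t -> Acc R w by move=> w; apply: H.
  elim/(well_founded_ind (@olt_wf o)): t w => t IHt w.
  elim/(well_founded_ind (@olt_wf W)): w => w IHw wt.
  constructor=> v [vw|[vw vw']]; first by apply: (IHt (rho v)) => //; rewrite -wt.
  by apply: IHw => //; rewrite vw.
- move=> v w vw; have [e|/olt_neq[]] := pselect (rho v = rho w).
  + by have [h|h] := @olt_neq W _ _ vw; [left|right]; right; split.
  + by left; left.
  + by right; left.
- move=> w iw; pose m := rho w.
  have iS : emb (below i) (option (below m) * option (below m)).
    apply: (emb_trans iw).
    suff: emb {v | R v w} ({j : o | ole j m} * {j : o | ole j m}).
      by move=> h; apply: (emb_trans h); apply: emb_prod; apply: emb_ole.
    have le12 v : R v w -> ole (sval v.1) m /\ ole (sval v.2) m.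
      move=> Rv; have : ole (rho v) m.
        by case: Rv => [/oltW //|[-> _]]; apply: ole_refl.
      rewrite /rho; case: ifP => [h|/negbT/oltW h] h'; split=> //.
        exact: ole_trans h'.
      exact: ole_trans h'.
    exists (fun v => (exist _ (sval (sval v).1) (le12 _ (svalP v)).1,
                      exist _ (sval (sval v).2) (le12 _ (svalP v)).2)).
    move=> [[v1 v2] hv] [[u1 u2] hu] /= [/below_val_inj v1E /below_val_inj v2E].
    by subst u1 u2; rewrite (Prop_irrelevance hv hu).
  (* If [below m] is infinite, induction embeds [below i] into it, against [noj]; if it is finite,
     [below i] would be finite too. *)
  have [infm|finm] := pselect (emb nat (below m)).
    apply: noj; exists m; first exact: rho_lt.
    apply: (emb_trans iS); apply: (emb_trans _ (IH m _ infm)); last exact: rho_lt.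
    by apply: emb_prod; apply: emb_option.
  have /emb_natP := emb_trans infi iS; apply; apply: finite_setT_prod;
    by apply: finite_setT_option; apply: contrapT => /emb_natP.
Qed.

Lemma emb_square T : emb nat T -> emb (T * T) T.
Proof.
move=> infT; have [r rwo] := well_orderable T; pose o := Ord rwo.
have toN : emb T (@below (osucc o) None) := @below_None o.
have ofN : emb (@below (osucc o) None) T := @emb_None_below o.
apply: (emb_trans (emb_prod toN toN)).
by apply: (emb_trans _ ofN); apply: emb_square_below; apply: emb_trans toN.
Qed.

Lemma emb_sum_square A B T : emb nat T -> emb A T -> emb B T -> emb (A + B) T.
Proof.
move=> infT AT BT; apply: (emb_trans (emb_sum AT BT)).
apply: (emb_trans _ (emb_square infT)); have [f fi] := infT.
exists (fun x => match x with inl a => (f 0, a) | inr a => (f 1, a) end).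
by move=> [a|a] [b|b] [] // => [-> //|/fi //|/fi //|->].
Qed.

(** Iterated pairing need only separate sequences of equal length, since the length is coded as
    well. *)
Lemma emb_seq_self T : emb nat T -> emb (seq T) T.
Proof.
move=> infT; have [f fi] := infT; have [g gi] := emb_square infT.
pose code := foldr (fun x y => g (x, y)) (f 0).
exists (fun s => g (f (size s), code s)) => s t /gi[/fi]; clear -gi.
elim: s t => [|x s IH] [|y t] //= [st] /gi[-> /IH ->] //.
Qed.

(** * Cardinals as initial ordinals *)

Lemma below_wo (o : ord) (i : o) :
  well_order (fun x y : below i => ole (sval x) (sval y)).
Proof.
apply: antisymmetric_well_order.
  by move=> x y /andP[xy yx]; apply/below_val_inj/ole_anti.
move=> A [x0 Ax0].
have [|_ [x <- Ax] xl] := @ole_min o (fun t => exists2 x : below i, sval x = t & x \in A).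
  by exists (sval x0), x0.
by exists x; split=> // y Ay; apply: xl; exists y.
Qed.

Definition below_ord (o : ord) (i : o) : ord := Ord (@below_wo o i).

(** A well order of [X] is cut at the least point whose initial segment still receives [X], or kept
    whole if there is none. *)
Lemma ex_cardinal (X : Type) :
  exists mu : ord, [/\ is_cardinal mu, emb mu X & emb X mu].
Proof.
have [r rwo] := well_orderable X; pose o := Ord rwo.
have [ex|nex] := pselect (exists i : o, emb X (below i)); last first.
  exists o; split; [|exact: emb_refl..] => i; apply/negP => /emb_cardP Xi.
  by apply: nex; exists i.
have [i Xi il] := ole_min ex.
exists (@below_ord o i); split=> //; last by exists sval; apply: below_val_inj.
move=> [j ji]; apply/negP => /emb_cardP/(emb_trans Xi) Xj.
have /negP := ji; apply; apply: il; apply: emb_trans Xj _.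
exists (fun k => exist (fun k => olt k j) (sval (sval k)) (svalP k)).
by move=> x y /(congr1 sval)/= xy; do 2!apply: below_val_inj.
Qed.

Lemma emb_successor (lam lamp : ord) (X : Type) :
  is_successor_cardinal lam lamp -> ~ emb X lam -> emb lamp X.
Proof.
move=> [_ _ least] nX; have [mu [cmu muX Xmu]] := ex_cardinal X.
apply: (emb_trans _ muX); apply/emb_cardP/least => //.
by apply/negP => /emb_cardP/(emb_trans Xmu).
Qed.

Lemma cantor T : ~ emb (T -> bool) T.
Proof.
move=> /emb_surj_inv[]; first by exists; exact: (fun=> true).
by move=> f /(_ (fun x => ~~ f x x))[x] /(congr1 (@^~ x)); case: (f x x).
Qed.

(** * Sequences of bounded length *)

Lemma emb_seq_lt_at (o : ord) (i : o) M : emb (below i -> M) (seq_lt o M).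
Proof.
exists (fun a => existT (fun i : o => below i -> M) i a) => a b.
exact: (@existT_inj2 {classic o}).
Qed.

(* Sequences indexed by ordinals of cardinality at most [I] are functions on
   [I] together with their length. *)
Lemma emb_seq_lt (I M : Type) (o : ord) :
    emb nat M -> emb (I -> M) M -> emb o M ->
    (forall i : o, emb (below i) I) ->
  emb (seq_lt o M) M.
Proof.
move=> infM IM oM oI.
suff h : emb (seq_lt o M) (o * (I -> M)).
  exact: emb_trans h (emb_trans (emb_prod oM IM) (emb_square infM)).
have Minh : inhabited M by have [g _] := infM; exists; exact: g 0.
pose f (i : o) := cid (emb_fun Minh (oI i)).
exists (fun x => (tag x, projT1 (f (tag x)) (tagged x))) => -[i a] [j b] /= [ij].
by subst j => /(projT2 (f i)) ->.
Qed.

(** Constant sequences; [j] shows that the length is nonzero, so the constant can be read off. *)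
Lemma emb_self_seq_lt M (o : ord) (i : o) (j : below i) : emb M (seq_lt o M).
Proof.
apply: emb_trans (emb_seq_lt_at i M); exists (fun x _ => x) => x y.
by move=> /(congr1 (@^~ j)).
Qed.

(** * The ordinal [Upsilon] and the cardinal equation *)

Section Upsilon.
Variables lam lamp kap : ord.
Hypothesis hlam : infinite_cardinal lam.
Hypothesis hlamp : is_successor_cardinal lam lamp.
Hypothesis hkap : infinite_cardinal kap.
Hypothesis hkap_le : [set: kap] #<= [set: lamp].

Local Notation U := (Upsilon lam kap).

Lemma emb_nat_lam : emb nat lam.
Proof. by apply/emb_natP; case: hlam. Qed.

Lemma UpsilonP : (U = kap /\ emb kap lam) \/ (U = osucc lam /\ ~ emb kap lam).
Proof. by rewrite /Upsilon; case: emb_cardP; [left|right]. Qed.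

Lemma emb_lt_kap X : ~ emb kap lam -> ~ emb kap X -> emb X lam.
Proof.
move=> nkap nX; apply: contrapT => /(emb_successor hlamp) lX.
by apply: nX; apply: emb_trans lX; apply/emb_cardP.
Qed.

Lemma emb_Upsilon : emb U lam.
Proof.
case: UpsilonP => [[->]//|[-> _]]; exact: (emb_option emb_nat_lam).
Qed.

(** Provides a single length [i] at which the fewer than [kap] free variables of a subformula can be
    listed. *)
Lemma lt_kap_Upsilon X : ~ emb kap X -> exists i : U, emb X (below i).
Proof.
case: UpsilonP => [[-> _]|[-> nkap]] nX.
  by apply: contrapT => ni; apply/nX/emb_ord => i Xi; apply: ni; exists i.
by exists None; apply: emb_trans (@below_None lam); apply: emb_lt_kap.
Qed.

Lemma finite_lt_kap (n : nat) : ~ emb kap 'I_n.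
Proof.
move=> kn; case: hkap => _ /emb_natP/emb_trans/(_ kn)/emb_natP; apply.
exact: finite_finset.
Qed.

Section Model.
Variable M : Type.
Hypothesis lamM : emb lam M.

(** If [kap] does not embed into [lam], both sides amount to an injection of [lam -> M] into [M]. *)
Lemma emb_seq_lt_kap_Upsilon : emb (seq_lt kap M) M <-> emb (seq_lt U M) M.
Proof.
have infM := emb_trans emb_nat_lam lamM.
have Minh : inhabited M by have [g _] := infM; exists; exact: g 0.
case: UpsilonP => [[-> _]//|[-> nkap]].
suff [h1 h2] : (emb (seq_lt kap M) M <-> emb (lam -> M) M) /\
          (emb (seq_lt (osucc lam) M) M <-> emb (lam -> M) M).
  by rewrite h1 h2.
split; split.
- have [i lami] : exists i : kap, emb lam (below i).
    apply: contrapT => ni; apply/nkap/emb_ord => i lami.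
    by apply: ni; exists i.
  apply: emb_trans; apply: emb_trans (emb_fun Minh lami) _.
  exact: emb_seq_lt_at.
- move=> lM; apply: (emb_seq_lt infM lM) => //.
    (* The lengths themselves must fit into [M]: in cardinality, $\kappa\le\lambda^+\le 2^\lambda\le
       |M|^\lambda\le |M|$. *)
    have kb : emb kap (lam -> bool).
      apply: (emb_trans (emb_cardP _ _ hkap_le)).
      by apply: emb_successor hlamp _; apply: cantor.
    apply: (emb_trans kb); apply: emb_trans lM.
    have [f fi] : emb bool M.
      apply: emb_trans lamM; apply: emb_trans emb_nat_lam.
      by exists (fun b : bool => b : nat); case; case.
    exists (fun h x => f (h x)) => h h' e; apply/funext => x.
    exact/fi/(congr1 (@^~ x) e).
  move=> i; apply: emb_lt_kap => // /emb_cardP ki.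
  by case: hkap => /(_ i); rewrite ki.
- apply: emb_trans; apply: emb_trans (emb_fun Minh (@below_None lam)) _.
  exact: emb_seq_lt_at.
- move=> lM; have lam1 := emb_option emb_nat_lam.
  apply: (emb_seq_lt infM lM); first exact: emb_trans lam1 lamM.
  by move=> i; apply: emb_trans lam1; exists sval; apply: (@below_val_inj (osucc lam)).
Qed.

(** As [M] receives [lam], the sum is bounded by [M] once the sequences are; the other inequality
    uses constant sequences of a nonzero length. *)
Lemma card_M_iff :
  [set: M] #= [set: (seq_lt kap M + lam)%type] <-> emb (seq_lt U M) M.
Proof.
rewrite -emb_seq_lt_kap_Upsilon card_eq_le; split.
  move=> /andP[_ /emb_cardP]; apply: emb_trans.
  by exists inl => x y [].
move=> sM; apply/andP; split; apply/emb_cardP; last first.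
  exact: emb_sum_square (emb_trans emb_nat_lam lamM) sM lamM.
have [i [f _]] : exists i : kap, emb 'I_1 (below i).
  apply: contrapT => ni; apply: (@finite_lt_kap 1); apply: emb_ord => i h.
  by apply: ni; exists i.
by apply: emb_trans (emb_self_seq_lt M (f ord0)) _; exists inl => x y [].
Qed.

End Model.
End Upsilon.

(** * Short tuples, and dependence of truth on the free variables *)

Lemma mktuple1 T (f : 'I_1 -> T) : [tuple f i | i < 1] = [tuple f ord0].
Proof. by apply: eq_from_tnth => i; rewrite tnth_mktuple (ord1 i). Qed.

Lemma mktuple2 T (f : 'I_2 -> T) :
  [tuple f i | i < 2] = [tuple f ord0; f ord_max].
Proof.
apply: eq_from_tnth => i; rewrite tnth_mktuple.
by case: i => -[|[|//]] h; rewrite (tnth_nth (f ord0)) /=; congr f; apply: val_inj.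
Qed.

Lemma eval_ext tau V (M : structure tau) (s s' : V -> M) (t : term tau V) :
  (forall v, tvars t v -> s v = s' v) -> eval s t = eval s' t.
Proof.
elim: t => [v|n f ts IH] /= ss'; first exact: ss'.
congr (fint f _); apply: eq_from_tnth => i; rewrite !tnth_mktuple.
by apply: IH => v vi; apply: ss'; exists i.
Qed.

Lemma holds_ext tau V (M : structure tau) (phi : formula tau V) (s s' : V -> M) :
  (forall v, fvars phi v -> s v = s' v) -> holds s phi <-> holds s' phi.
Proof.
elim: phi s s' => [[t u|n r ts]|psi IH|J psis IH|X psi IH] s s' /= ss'.
- have -> : eval s t = eval s' t by apply: eval_ext => v vt; apply: ss'; left.
  by have -> : eval s u = eval s' u by apply: eval_ext => v vu; apply: ss'; right.
- suff -> : [tuple eval s (ts i) | i < n] = [tuple eval s' (ts i) | i < n] by [].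
  apply: eq_from_tnth => i; rewrite !tnth_mktuple; apply: eval_ext => v vi.
  by apply: ss'; exists i.
- by rewrite (IH s s').
- have H j : holds s (psis j) <-> holds s' (psis j).
    by apply: IH => v vj; apply: ss'; exists j.
  by split=> h j; apply/H.
- suff H (r r' : V -> M) : (forall v, (fvars psi `\` X) v -> r v = r' v) ->
      holds r (Exists X psi) -> holds r' (Exists X psi).
    by split; apply: H => // v /ss'.
  move=> {}ss' [t [ts ht]].
  (* The witness keeps [t] on the quantified block and follows [r'] elsewhere. *)
  exists (fun v => if pselect (X v) then t v else r' v); split.
    by move=> v nX; case: pselect.
  apply: (IH t _ _).1 ht => v vpsi; case: pselect => // nX.
  by rewrite ts // ss'.
Qed.

(** * Subformulas, indexed by finite sequences below [lam] *)

(* A conjunction which is not indexed by a quotient of [lam] (in [L_{lam^+,kap}],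
   an empty one) is its own child. *)
Definition child tau V (lam : ord) (phi : formula tau V) (k : lam) :
    formula tau V :=
  match phi with
  | Atom _ => phi
  | Neg psi => psi
  | Conj J psis =>
      if pselect (exists f : lam -> J, forall j, exists k, f k = j) is left h
      then psis (projT1 (cid h) k) else phi
  | Exists _ psi => psi
  end.

(* The step closest to the root comes last in the sequence. *)
Fixpoint subformula tau V (lam : ord) (psi : formula tau V) (p : seq lam) :
    formula tau V :=
  if p is k :: q then child (subformula psi q) k else psi.

Lemma in_L_child (lam kap : ord) tau V (phi : formula tau V) (k : lam) :
  in_L lam kap phi -> in_L lam kap (child phi k).
Proof.
case: phi => [a|psi|J psis|X psi] //= [hv]; [by []|case=> hJ hpsis|by case].
by case: pselect => //= h; apply: hpsis.
Qed.

Lemma in_L_subformula (lam kap : ord) tau V (psi : formula tau V) (p : seq lam) :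
  in_L lam kap psi -> in_L lam kap (subformula psi p).
Proof. by move=> hpsi; elim: p => //= k p; apply: in_L_child. Qed.

Lemma in_L_fvars (lam kap : ord) tau V (phi : formula tau V) :
  in_L lam kap phi -> ~ emb kap (fvars phi).
Proof. by case: phi => [a|psi|J psis|X psi] [hv _] /emb_set_rP; apply/negP. Qed.

(** A nonempty [J] embedded in [lam] is a quotient of [lam], so every conjunct occurs as a child. *)
Lemma child_Conj (lam : ord) tau V J (psis : J -> formula tau V) (j : J) :
  emb J lam -> exists k : lam, child (Conj psis) k = psis j.
Proof.
move=> Jlam /=; case: pselect => [h|[]]; last first.
  by apply: emb_surj_inv => //; exists; exact: j.
by have [k kj] := projT2 (cid h) j; exists k; congr psis.
Qed.

Definition is_Conj tau V (phi : formula tau V) : bool :=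
  if phi is Conj _ _ then true else false.

Definition is_Exists tau V (phi : formula tau V) : bool :=
  if phi is Exists _ _ then true else false.

Lemma fvars_child (lam : ord) tau V (phi : formula tau V) (k : lam) :
  ~~ is_Exists phi -> fvars (child phi k) `<=` fvars phi.
Proof.
case: phi => [a|psi|J psis|//] _ v //=; case: pselect => [h vh|//].
by exists (projT1 (cid h) k).
Qed.

(** * The expanded vocabulary *)

(* [Cst], [Coord], [Length] and [Index] are the symbols [c_i], [F_i], [P_i] and
   [P_*] of the statement. *)
Inductive new_fsymb (lam U : ord) : Type :=
| Cst of lam
| Coord of U
| Recode of seq lam
| Failing of seq lam
| Clash of seq lam.

Inductive new_rsymb (lam U : ord) : Type :=
| Length of U
| Index
| Sat of seq lam.

(* Every new symbol is available in every arity; each one is only used in the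
   arity given by [cname], [coord] etc. below. *)
Definition vocab1 (lam U : ord) (tau0 : vocab) : vocab :=
  Vocab (fun n => (fsymb tau0 n + new_fsymb lam U)%type)
        (fun n => (rsymb tau0 n + new_rsymb lam U)%type).

Definition vocab1_incl (lam U : ord) (tau0 : vocab) :
    vocab_incl tau0 (vocab1 lam U tau0) :=
  @VocabIncl tau0 (vocab1 lam U tau0)
    (fun n => inl) (fun n => inl)
    (fun n x y e => let: erefl := e in erefl)
    (fun n x y e => let: erefl := e in erefl).

Lemma card_vocab1 (lam U : ord) (tau0 : vocab) :
    emb nat lam -> emb U lam -> [set: symbols tau0] #<= [set: lam] ->
  [set: symbols (vocab1 lam U tau0)] #= [set: lam].
Proof.
move=> inf [u ui] /emb_cardP tau0lam.
rewrite card_eq_le; apply/andP; split; apply/emb_cardP; last first.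
  exists (fun k => inl (existT (fsymb (vocab1 lam U tau0)) 0 (inr (Cst U k)))).
  by move=> x y [].
have nat_seq : emb (nat * (nat * seq lam)) lam.
  have h := emb_square inf.
  apply: emb_trans h; apply: emb_prod => //; apply: emb_trans (emb_square inf).
  by apply: emb_prod => //; apply: emb_seq_self.
(* The first component tells the kinds of symbols apart; the arity is paired in later, since each
   new symbol is available in all arities. *)
pose cf (s : new_fsymb lam U) : nat * seq lam := match s with
  | Cst k => (0, [:: k]) | Coord i => (1, [:: u i]) | Recode p => (2, p)
  | Failing p => (3, p) | Clash p => (4, p) end.
pose cr (s : new_rsymb lam U) : nat * seq lam := match s with
  | Length i => (0, [:: u i]) | Index => (1, [::]) | Sat p => (2, p) end.
have cfi : injective cf.
  by move=> [k|i|p|p|p] [k'|i'|p'|p'|p'] //= [] => [->|/ui ->|->|->|->].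
have cri : injective cr by move=> [i||p] [i'||p'] //= [] => [/ui ->|->].
suff h : emb (symbols (vocab1 lam U tau0))
    (symbols tau0 + (nat * (nat * seq lam) + nat * (nat * seq lam))).
  apply: (emb_trans h); apply: emb_sum_square => //.
  exact: emb_sum_square.
exists (fun s => match s with
  | inl (existT n (inl f)) => inl (inl (existT _ n f))
  | inl (existT n (inr f)) => inr (inl (n, cf f))
  | inr (existT n (inl r)) => inl (inr (existT _ n r))
  | inr (existT n (inr r)) => inr (inr (n, cr r))
  end).
move=> [[n [f|f]]|[n [f|f]]] [[m [g|g]]|[m [g|g]]] //= [].
- by move=> nm; subst m => e; rewrite (existT_inj2 e).
- by move=> <- /cfi ->.
- by move=> nm; subst m => e; rewrite (existT_inj2 e).
- by move=> <- /cri ->.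
Qed.

(** * The new symbols as operations on a structure *)

Section Operations.
Variables (lam U : ord) (tau0 : vocab).
Local Notation tau1 := (vocab1 lam U tau0).
Variable M : structure tau1.
Implicit Types (b : M) (p : seq lam).

Definition cname (k : lam) : M :=
  fint (inr (Cst U k) : fsymb tau1 0) [tuple].
Definition coord (i : U) b : M :=
  fint (inr (Coord lam i) : fsymb tau1 1) [tuple b].
Definition recode p b : M :=
  fint (inr (Recode U p) : fsymb tau1 1) [tuple b].
Definition failing p b : M :=
  fint (inr (Failing U p) : fsymb tau1 1) [tuple b].
Definition clash p b b' : M :=
  fint (inr (Clash U p) : fsymb tau1 2) [tuple b; b'].
Definition is_cname b : Prop :=
  rint (inr (Index lam U) : rsymb tau1 1) [tuple b].
Definition sat p b : Prop :=
  rint (inr (Sat U p) : rsymb tau1 1) [tuple b].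

(** The index [k0] makes the type nonempty, so that a realization does satisfy [P_*]. *)
Lemma omits_ptype (k0 : lam) :
  omits M (ptype (inr (Index lam U) : rsymb tau1 1)
                 (fun k => inr (Cst U k) : fsymb tau1 0)) <->
  (forall b, is_cname b -> exists k, b = cname k).
Proof.
have E (b : M) : realizes (ptype (inr (Index lam U) : rsymb tau1 1)
      (fun k => inr (Cst U k) : fsymb tau1 0)) b <->
    (forall k, is_cname b /\ b <> cname k).
  have C k : fint (inr (Cst U k) : fsymb tau1 0)
      [tuple b | _ < 0] = cname k by congr fint; apply: val_inj; case: mktuple => -[].
  split=> [h k|h _ [k _ <-]] /=; last first.
    by rewrite mktuple1 C; apply: h.
  by have /= := h _ (ex_intro2 _ _ k I erefl); rewrite mktuple1 C.
split=> [nex b ib|h [b /E hb]].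
  apply: contrapT => nk; apply: nex; exists b; apply/E => k; split=> // bk.
  by apply: nk; exists k.
by have [k] := h b (hb k0).1; have [] := hb k.
Qed.

End Operations.

(** * Universal closure in two variables *)

Definition vars01 : set nat := [set n | (n < 2)%N].

Definition fo_forall tau (x : nat) (phi : fo tau) : fo tau :=
  FONeg (FOExists x (FONeg phi)).

Definition fo_close tau (phi : fo tau) : fo tau := fo_forall 0 (fo_forall 1 phi).

Lemma fo_fvars_close tau (phi : fo tau) :
  fo_fvars phi `<=` vars01 -> fo_fvars (fo_close phi) = set0.
Proof.
move=> phi01; apply/seteqP; split=> // v [[/phi01 v01 n1] n0].
by case: v v01 n1 n0 => [_ _ n0|[_ n1 _|//]]; [case: n0|case: n1].
Qed.

Lemma fo_holds_close tau (M : structure tau) (phi : fo tau) :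
  (forall s : nat -> M, fo_holds s phi) <->
  (forall s : nat -> M, fo_holds s (fo_close phi)).
Proof.
split=> h s /=.
  by move=> [s1 [_ n1]]; apply: n1 => -[s2 [_ n2]]; apply: n2; apply: h.
apply: contrapT => nh; apply: (h s); exists s; split=> // k; apply: k.
by exists s.
Qed.

(** * Statements expressible by a first-order formula in the variables 0, 1 *)

Section Definable.
Variable tau : vocab.

(** The structure is an argument of [t], so that one term serves all structures; axioms can then be
    written as propositions about [M] and [s]. *)
Definition dterm (t : forall M : structure tau, (nat -> M) -> M) : Prop :=
  exists2 u : term tau nat, tvars u `<=` vars01 &
    forall (M : structure tau) (s : nat -> M), eval s u = t M s.

Definition dform (Q : forall M : structure tau, (nat -> M) -> Prop) : Prop :=
  exists2 phi : fo tau, fo_fvars phi `<=` vars01 &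
    forall (M : structure tau) (s : nat -> M), fo_holds s phi <-> Q M s.

Implicit Types t u : forall M : structure tau, (nat -> M) -> M.
Implicit Types P Q : forall M : structure tau, (nat -> M) -> Prop.

Lemma dterm0 : dterm (fun M s => s 0).
Proof. by exists (Var 0) => // _ ->. Qed.

Lemma dterm1 : dterm (fun M s => s 1).
Proof. by exists (Var 1) => // _ ->. Qed.

Lemma dterm_app0 (f : fsymb tau 0) : dterm (fun M s => fint f [tuple]).
Proof.
exists (App f (fun _ => Var 0)) => [v [[]]//|M s /=]; congr fint.
by apply: val_inj; case: mktuple => -[].
Qed.

Lemma dterm_app1 (f : fsymb tau 1) t :
  dterm t -> dterm (fun M s => fint f [tuple t M s]).
Proof.
move=> [t' t01 tE]; exists (App f (fun _ => t')) => [v [_ _ /t01]//|M s /=].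
by rewrite mktuple1 tE.
Qed.

Lemma dterm_app2 (f : fsymb tau 2) t u : dterm t -> dterm u ->
  dterm (fun M s => fint f [tuple t M s; u M s]).
Proof.
move=> [t' t01 tE] [u' u01 uE].
exists (App f (fun i => if i == ord0 then t' else u')).
  by move=> v [i _]; case: ifP => _ => [/t01|/u01].
by move=> M s /=; rewrite mktuple2 /= tE uE.
Qed.

Lemma dform_eq t u : dterm t -> dterm u -> dform (fun M s => t M s = u M s).
Proof.
move=> [t' t01 tE] [u' u01 uE]; exists (FOAtom (Equal t' u')).
  by move=> v [/t01|/u01].
by move=> M s /=; rewrite tE uE.
Qed.

Lemma dform_rel1 (r : rsymb tau 1) t :
  dterm t -> dform (fun M s => rint r [tuple t M s]).
Proof.
move=> [t' t01 tE]; exists (FOAtom (Rel r (fun _ => t'))) => [v [_ _ /t01]//|M s /=].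
by rewrite mktuple1 tE.
Qed.

Lemma dform_not P : dform P -> dform (fun M s => ~ P M s).
Proof.
move=> [phi phi01 phiE]; exists (FONeg phi) => // M s /=.
by rewrite phiE.
Qed.

Lemma dform_imp P Q : dform P -> dform Q -> dform (fun M s => P M s -> Q M s).
Proof.
move=> [phi phi01 phiE] [chi chi01 chiE].
exists (FONeg (FOAnd phi (FONeg chi))) => [v [/phi01|/chi01]//|M s /=].
rewrite phiE chiE; split=> [h p|h [p]]; last by apply; apply: h.
by apply: contrapT => q; apply: h.
Qed.

Lemma dform_iff P Q : dform P -> dform Q -> dform (fun M s => P M s <-> Q M s).
Proof.
move=> dP dQ; have [phi phi01 phiE] := dform_imp dP dQ.
have [chi chi01 chiE] := dform_imp dQ dP.
exists (FOAnd phi chi) => [v [/phi01|/chi01]//|M s /=].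
by rewrite phiE chiE.
Qed.

Variable K : structure tau -> Prop.

Definition theory_of_class : set (fo tau) := [set phi | fo_fvars phi = set0 /\
  forall M : structure tau, K M -> forall s : nat -> M, fo_holds s phi].

Lemma fo_theory_of_class : fo_theory theory_of_class.
Proof. by move=> phi []. Qed.

Lemma fo_models_class M : K M -> fo_models M theory_of_class.
Proof. by move=> KM phi [_]; apply. Qed.

(** The universal closure of the formula for [Q] is a sentence true throughout [K], hence a member
    of the theory. This replaces an explicit list of axioms. *)
Lemma class_transfer Q (N : structure tau) : dform Q ->
    (forall M : structure tau, K M -> forall s : nat -> M, Q M s) ->
  fo_models N theory_of_class -> forall s : nat -> N, Q N s.
Proof.
move=> [phi phi01 phiE] KQ NT s; apply/phiE; apply: (fo_holds_close N phi).2 s => s.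
apply: NT; split; first exact: fo_fvars_close.
by move=> M KM; apply: (fo_holds_close M phi).1 => s'; apply/phiE/KQ.
Qed.

End Definable.

(** * The theory *)

Section Main.
Variables (lam U kap : ord) (tau0 : vocab) (V : Type) (psi : formula tau0 V).
Hypothesis hpsi : in_L lam kap psi.
Local Notation tau1 := (vocab1 lam U tau0).
Local Notation sub := (@subformula tau0 V lam psi).
Local Notation red := (reduct (vocab1_incl lam U tau0)).

(** Codes for the subformula at [p] keep the value of [v] at coordinate [e p v]; [u] gives each
    coordinate a constant as its name, and [k0] selects a child where all children coincide. *)
Variables (k0 : lam) (u : U -> lam) (e : seq lam -> V -> U).
Hypothesis u_inj : injective u.
Hypothesis e_inj : forall p v w,
  fvars (sub p) v -> fvars (sub p) w -> e p v = e p w -> v = w.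
Hypothesis e_bound : forall p, exists i, forall v, fvars (sub p) v -> olt (e p v) i.

Definition assignment (M : structure tau1) (p : seq lam) (b : M) : V -> red M :=
  fun v => coord (e p v) b.

(** Infinitary clauses such as [int_sat] are harmless here, because the theory keeps only their
    first-order consequences. *)
Record intended (M : structure tau1) : Prop := Intended {
  int_cname : injective (@cname _ _ _ M);
  int_failing : forall p (b : M), is_cname (failing p b);
  int_clash : forall p (b b' : M), is_cname (clash p b b');
  int_sat : forall p (b : M), sat p b <-> holds (assignment p b) (sub p);
  int_recode : forall k p (b : M) v,
    fvars (sub p) v -> fvars (sub (k :: p)) v ->
    assignment (k :: p) (recode (k :: p) b) v = assignment p b v;
  int_witness : forall k p (b : M), is_Exists (sub p) ->
    sat p b -> sat (k :: p) (recode (k :: p) b);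
  int_falsify : forall p (b : M), is_Conj (sub p) -> ~ sat p b ->
    exists2 k, failing p b = cname M k & ~ sat (k :: p) (recode (k :: p) b);
  int_separate : forall k p (b b' : M), is_Exists (sub p) ->
    sat (k :: p) b' -> ~ sat p b ->
    exists v, [/\ fvars (sub p) v,
      assignment (k :: p) b' v <> assignment p b v &
      clash (k :: p) b b' = cname M (u (e p v))];
  int_psi : models (red M) psi }.

(** An assignment enters a term only through coordinates of its code, and the code is the
    first-order variable 0. *)
Fixpoint tsubst (p : seq lam) (t : term tau0 V) : term tau1 nat :=
  match t with
  | Var v => App (inr (Coord lam (e p v)) : fsymb tau1 1) (fun _ => Var 0)
  | App n f ts => App (inl f : fsymb tau1 n) (fun i => tsubst p (ts i))
  end.

Lemma tvars_tsubst p t : tvars (tsubst p t) `<=` vars01.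
Proof.
by elim: t => [v|n f ts IH] /= w [i _]; [move=> ->|apply: IH].
Qed.

Lemma eval_tsubst (M : structure tau1) (s : nat -> M) p t :
  eval s (tsubst p t) = eval (assignment p (s 0)) t.
Proof.
elim: t => [v|n f ts IH] /=; first by rewrite mktuple1.
by congr fint; apply: eq_from_tnth => i; rewrite !tnth_mktuple IH.
Qed.

Lemma dform_atom p (a : atom tau0 V) :
  dform (fun M s => atom_holds (assignment p (s 0)) a).
Proof.
case: a => [t t'|n r ts].
  exists (FOAtom (Equal (tsubst p t) (tsubst p t'))).
    by move=> v [] /tvars_tsubst.
  by move=> M s /=; rewrite !eval_tsubst.
exists (FOAtom (Rel (inl r : rsymb tau1 n) (fun i => tsubst p (ts i)))).
  by move=> v [i _] /tvars_tsubst.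
move=> M s /=; suff -> : [tuple eval s (tsubst p (ts i)) | i < n] =
  [tuple eval (assignment p (s 0)) (ts i) | i < n] by [].
by apply: eq_from_tnth => i; rewrite !tnth_mktuple eval_tsubst.
Qed.

Definition theory1 : set (fo tau1) := theory_of_class intended.

(** Outside the existential case the child has no new free variable, so [recode] preserves all
    values on which its truth depends. *)
Lemma recode_holds (M : structure tau1) k p (b : M) :
    (forall v, fvars (sub p) v -> fvars (sub (k :: p)) v ->
      assignment (k :: p) (recode (k :: p) b) v = assignment p b v) ->
    ~~ is_Exists (sub p) ->
  holds (assignment (k :: p) (recode (k :: p) b)) (sub (k :: p)) <->
  holds (assignment p b) (sub (k :: p)).
Proof.
by move=> rec nE; apply: holds_ext => v vk; apply: rec => //; apply: fvars_child vk.
Qed.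

Lemma exists_code (M : Type) (F : U -> M -> M) (m0 : M) :
    (forall (i : U) (a : below i -> M), exists b, forall j, F (sval j) b = a j) ->
  forall p (s : V -> M), exists b, forall v, fvars (sub p) v -> F (e p v) b = s v.
Proof.
move=> codeF p s; have [i ip] := e_bound p.
(* Position [j] holds the value of the only free variable enumerated at [j], or [m0] if there is
   none. *)
have /choice[a aP] : forall j : below i, exists m,
    forall v, fvars (sub p) v -> e p v = sval j -> m = s v.
  move=> j; have [[v [vp vj]]|nv] :=
      pselect (exists v, fvars (sub p) v /\ e p v = sval j).
    by exists (s v) => w wp wj; congr s; apply: (e_inj vp wp); rewrite vj wj.
  by exists m0 => w wp wj; case: nv; exists w.
have [b bP] := codeF i a; exists b => v vp.
by rewrite -(aP (exist _ (e p v) (ip v vp)) v) // -bP.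
Qed.

Ltac definable := repeat first
  [ apply dform_not | apply dform_iff | apply dform_imp | apply dform_atom
  | apply dform_eq | apply dform_rel1 | apply dterm_app2
  | apply dterm_app1 | apply dterm_app0 | apply dterm0 | apply dterm1 ].

(** * Truth of [psi] in models of the theory omitting the type *)

Section Soundness.
Variable M : structure tau1.
Hypothesis MT : fo_models M theory1.
Hypothesis Momit : forall b : M, is_cname b -> exists k, b = cname M k.
Hypothesis Mcode :
  forall (i : U) (a : below i -> M), exists b, forall j, coord (sval j) b = a j.
Local Notation at2 b b' := (fun n : nat => if n is 0 then b else b').

Lemma cname_inj : injective (@cname _ _ _ M).
Proof.
move=> k k' kk'; apply: contrapT => nk; move: kk'.
apply: (@class_transfer _ intended
  (fun M s => cname M k <> cname M k') M _ _ MT (fun=> cname M k))=> //.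
  by definable.
by move=> N iN _ /(int_cname iN).
Qed.

Lemma recode_eq k p (b : M) v : fvars (sub p) v -> fvars (sub (k :: p)) v ->
  assignment (k :: p) (recode (k :: p) b) v = assignment p b v.
Proof.
move=> vp vk; apply: (@class_transfer _ intended
  (fun M s => coord (e (k :: p) v) (recode (k :: p) (s 0)) = coord (e p v) (s 0))
  M _ _ MT (fun=> b))=> //.
  by definable.
by move=> N iN s; apply: (int_recode iN).
Qed.

(** Induction on the formula, transferring one first-order condition at a time. Where an infinitary
    choice is required, a value in [P_*] is some [c_k] by omission, and the condition for this fixed
    [k] is first-order. *)
Lemma sat_iff phi p : sub p = phi ->
  forall b : M, sat p b <-> holds (assignment p b) phi.
Proof.
elim: phi p => [a|phi IH|J phis IH|X phi IH] p pE b.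
- apply: (@class_transfer _ intended
    (fun M s => sat p (s 0) <-> atom_holds (assignment p (s 0)) a)
    M _ _ MT (fun=> b)); first by definable.
  by move=> N iN s; rewrite (int_sat iN) pE.
- have kE : sub (k0 :: p) = phi by rewrite /= pE.
  have nE : ~~ is_Exists (sub p) by rewrite pE.
  have -> : sat p b <-> ~ sat (k0 :: p) (recode (k0 :: p) b).
    apply: (@class_transfer _ intended (fun M s => sat p (s 0) <->
      ~ sat (k0 :: p) (recode (k0 :: p) (s 0))) M _ _ MT (fun=> b)); first by definable.
    move=> N iN s; rewrite !(int_sat iN) recode_holds //; last exact: int_recode.
    by rewrite kE pE.
  rewrite /= (IH _ kE) -{1}kE recode_holds //; last exact: recode_eq.
  by rewrite kE.
- have nE : ~~ is_Exists (sub p) by rewrite pE.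
  have [_ [Jlam _]] : in_L lam kap (Conj phis).
    by rewrite -pE; apply: in_L_subformula.
  split=> [bp j|ball].
    have [k kE] := child_Conj phis j (elimT (emb_cardP _ _) Jlam).
    have {}kE : sub (k :: p) = phis j by rewrite /= pE.
    rewrite -kE; apply: (recode_holds (@recode_eq k p b) nE).1.
    rewrite kE; apply/(IH j _ kE); move: bp.
    apply: (@class_transfer _ intended (fun M s => sat p (s 0) ->
      sat (k :: p) (recode (k :: p) (s 0))) M _ _ MT (fun=> b)).
      by definable.
    move=> N iN s; rewrite !(int_sat iN) recode_holds //; last exact: int_recode.
    by rewrite kE pE; apply.
  apply: contrapT => nb.
  have [k kE] : exists k, failing p b = cname M k.
    apply: Momit; apply: (@class_transfer _ intended
      (fun M s => is_cname (failing p (s 0))) M _ _ MT (fun=> b)); first by definable.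
    by move=> N iN s; apply: int_failing.
  have : ~ sat (k :: p) (recode (k :: p) b).
    move: nb kE; apply: (@class_transfer _ intended (fun M s =>
      ~ sat p (s 0) -> failing p (s 0) = cname M k ->
      ~ sat (k :: p) (recode (k :: p) (s 0))) M _ _ MT (fun=> b)).
      by definable.
    move=> N iN s /(int_falsify iN)[|k' -> nk' /(int_cname iN) <- //].
    by rewrite pE.
  (* The failing child is one of the conjuncts, unless [J] is empty and the conjunction is its own
     child. *)
  have [[j kj]|nj] := pselect (exists j, sub (k :: p) = phis j).
    rewrite (IH j _ kj) -{1}kj recode_holds //; last exact: recode_eq.
    by rewrite kj.
  have noJ (j : J) : False.
    case: nj; rewrite /= pE /=; case: pselect => [h|[]].
      by exists (projT1 (cid h) k).
    by apply: emb_surj_inv; [apply/emb_cardP|exists].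
  case: nb; apply: (@class_transfer _ intended
    (fun M s => sat p (s 0)) M _ _ MT (fun=> b)); first by definable.
  by move=> N iN s; rewrite (int_sat iN) pE => j; case: (noJ j).
- have kE : sub (k0 :: p) = phi by rewrite /= pE.
  split=> [bp|[s' [ss' s'phi]]].
    (* [recode] acts as a Skolem function for the block [X]; outside [X] the old assignment is
       kept. *)
    exists (fun v => if pselect (X v) then
      assignment (k0 :: p) (recode (k0 :: p) b) v else assignment p b v).
    split=> [v nX|]; first by case: pselect.
    have : sat (k0 :: p) (recode (k0 :: p) b).
      move: bp; apply: (@class_transfer _ intended (fun M s =>
        sat p (s 0) -> sat (k0 :: p) (recode (k0 :: p) (s 0))) M _ _ MT (fun=> b)).
        by definable.
      by move=> N iN s; apply: int_witness; rewrite ?pE.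
    rewrite (IH _ kE); apply: (holds_ext _).1 => v vphi.
    by case: pselect => // nX; apply: recode_eq; rewrite ?kE // pE.
  have [b' b's] := exists_code b Mcode (k0 :: p) s'.
  have satb' : sat (k0 :: p) b'.
    apply/(IH _ kE); apply: (holds_ext _).2 s'phi => v vphi.
    by apply: b's; rewrite kE.
  apply: contrapT => nb.
  have [k kC] : exists k, clash (k0 :: p) b b' = cname M k.
    apply: Momit; apply: (@class_transfer _ intended
      (fun M s => is_cname (clash (k0 :: p) (s 0) (s 1))) M _ _ MT (at2 b b')).
      by definable.
    by move=> N iN s; apply: int_clash.
  (* If [c_k] names the coordinate of a free variable, the two codes differ there, although [s']
     agrees with the assignment of [b] off [X]; any other value of [clash] is excluded outright. *)
  have [[v [vp vk]]|nv] :=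
      pselect (exists v, fvars (sub p) v /\ u (e p v) = k).
    have : coord (e (k0 :: p) v) b' <> coord (e p v) b.
      move: satb' nb kC; rewrite -vk.
      apply: (@class_transfer _ intended (fun M s =>
        sat (k0 :: p) (s 1) -> ~ sat p (s 0) ->
        clash (k0 :: p) (s 0) (s 1) = cname M (u (e p v)) ->
        coord (e (k0 :: p) v) (s 1) <> coord (e p v) (s 0)) M _ _ MT (at2 b b')).
        by definable.
      move=> N iN s s1 s0; have [|w [wp + ->]] := int_separate iN _ s1 s0.
        by rewrite pE.
      by move=> + /(int_cname iN)/u_inj/(e_inj wp vp) wv; rewrite wv.
    apply; move: vp; rewrite pE => -[vphi nX].
    by rewrite b's ?kE // ss'.
  move: satb' nb kC; apply: (@class_transfer _ intended (fun M s =>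
    sat (k0 :: p) (s 1) -> ~ sat p (s 0) ->
    clash (k0 :: p) (s 0) (s 1) <> cname M k) M _ _ MT (at2 b b')).
    by definable.
  move=> N iN s s1 s0; have [|w [wp _ ->]] := int_separate iN _ s1 s0.
    by rewrite pE.
  by move=> /(int_cname iN) wk; apply: nv; exists w.
Qed.

Lemma theory1_psi : fvars psi = set0 -> models (red M) psi.
Proof.
move=> psi0 s; have [b] := univ_inh M.
have : sat [::] b.
  apply: (@class_transfer _ intended (fun M s => sat [::] (s 0)) M _ _ MT (fun=> b)).
    by definable.
  by move=> N iN s'; apply/(int_sat iN)/(int_psi iN).
move=> /(@sat_iff psi [::] erefl); apply: (holds_ext _).1 => v.
by rewrite psi0.
Qed.

End Soundness.

(** The reduct of [expand] is a rebuilt record, identified with [M0] only by case analysis. *)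
Lemma holds_eta (M : structure tau0) (s : V -> M) (phi : formula tau0 V) :
  @holds tau0 V (Structure (univ_inh M) (@fint _ M) (@rint _ M)) s phi <->
  holds s phi.
Proof. by case: M s. Qed.

(** * Intended expansions of models of [psi] *)

Section Expansion.
Variables (M0 : structure tau0) (m0 : M0).
Variables (c : lam -> M0) (F : U -> M0 -> M0) (P : U -> M0 -> Prop).
Hypothesis c_inj : injective c.
Hypothesis F_code :
  forall (i : U) (a : below i -> M0), exists b, forall j, F (sval j) b = a j.

(** Only [rec], [fail] and [cl] remain to be chosen. Arguments are read by [nth] with default [m0],
    because a new symbol is interpreted in every arity. *)
Definition expand (rec fail : seq lam -> M0 -> M0)
    (cl : seq lam -> M0 -> M0 -> M0) : structure tau1 :=
  @Structure tau1 M0 (univ_inh M0)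
    (fun n (f : fsymb tau1 n) t =>
       let x := nth m0 t in
       match f with
       | inl f0 => fint f0 t
       | inr (Cst k) => c k
       | inr (Coord i) => F i (x 0)
       | inr (Recode p) => rec p (x 0)
       | inr (Failing p) => fail p (x 0)
       | inr (Clash p) => cl p (x 0) (x 1)
       end)
    (fun n (r : rsymb tau1 n) t =>
       let b := nth m0 t 0 in
       match r with
       | inl r0 => rint r0 t
       | inr (Length i) => P i b
       | inr Index => exists k, b = c k
       | inr (Sat p) => holds (fun v => F (e p v) b) (sub p)
       end).

Lemma is_expansion_expand rec fail cl :
  is_expansion (vocab1_incl lam U tau0) M0 (expand rec fail cl).
Proof. by rewrite /is_expansion /reduct /expand /=; case: M0. Qed.

Lemma intended_expand : models M0 psi ->
  exists rec fail cl, intended (expand rec fail cl).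
Proof.
move=> M0psi; pose asg p b : V -> M0 := fun v => F (e p v) b.
have code := exists_code m0 F_code.
have /choice[rec recP] : forall qb : seq lam * M0, exists b', forall k p,
    qb.1 = k :: p ->
    (forall v, fvars (sub p) v -> fvars (sub (k :: p)) v ->
      asg (k :: p) b' v = asg p qb.2 v) /\
    (is_Exists (sub p) -> holds (asg p qb.2) (sub p) ->
      holds (asg (k :: p) b') (sub (k :: p))).
  move=> [[|k p] b]; first by exists m0.
  (* The new code keeps the old values, except that a true existential formula is given a witness on
     its block. *)
  have [s [sp sE]] : exists s : V -> M0,
      (forall v, fvars (sub p) v -> s v = asg p b v) /\
      (is_Exists (sub p) -> holds (asg p b) (sub p) -> holds s (sub (k :: p))).
    have [hE|nh] := pselect (is_Exists (sub p) /\ holds (asg p b) (sub p)).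
      move: hE => /=; case: (sub p) => [?|?|? ?|X phi] [] // _ [s [sX hs]].
      by exists s; split=> // v [_ /sX].
    by exists (asg p b); split=> // pE hp; case: nh.
  have [b' b's] := code (k :: p) s; exists b' => k' p' [<- <-]; split.
    by move=> v vp vk; rewrite -sp // -b's.
  by move=> pE hp; apply: (holds_ext _).2 (sE pE hp) => v; apply: b's.
pose rc p b := rec (p, b).
have /choice[fail failP] : forall pb : seq lam * M0, exists k : lam,
    is_Conj (sub pb.1) -> ~ holds (asg pb.1 pb.2) (sub pb.1) ->
    ~ holds (asg (k :: pb.1) (rc (k :: pb.1) pb.2)) (sub (k :: pb.1)).
  move=> [p b] /=.
  have [[pC np]|h] := pselect (is_Conj (sub p) /\ ~ holds (asg p b) (sub p));
    last by exists k0 => pC np; case: h.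
  have pL := in_L_subformula p hpsi.
  have rcE k v : fvars (sub p) v -> fvars (sub (k :: p)) v ->
      asg (k :: p) (rc (k :: p) b) v = asg p b v.
    by have [h _] := recP (k :: p, b) k p erefl; apply: h.
  have [k nk] : exists k, ~ holds (asg p b) (sub (k :: p)).
    move: pC np pL => /=; case: (sub p) => // J phis _ /= nall [_ [Jlam _]].
    have [j nj] : exists j, ~ holds (asg p b) (phis j).
      apply: contrapT => nj; apply: nall => j; apply: contrapT => h.
      by apply: nj; exists j.
    have [k kE] := child_Conj phis j (elimT (emb_cardP _ _) Jlam).
    by exists k; rewrite -[X in holds _ X]/(child (Conj phis) k) kE.
  (* A conjunct failing at the old assignment also fails at the recoded one, since they agree on its
     free variables. *)
  exists k => _ _ h; apply: nk; apply: (holds_ext _).1 h => v vk.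
  apply: rcE => //; apply: fvars_child vk.
  by case: (sub p) pC.
have /choice[cl clP] : forall qbb : seq lam * M0 * M0, exists k : lam,
    forall k' p, qbb.1.1 = k' :: p -> is_Exists (sub p) ->
    holds (asg (k' :: p) qbb.2) (sub (k' :: p)) ->
    ~ holds (asg p qbb.1.2) (sub p) ->
    exists v, [/\ fvars (sub p) v,
      asg (k' :: p) qbb.2 v <> asg p qbb.1.2 v & k = u (e p v)].
  move=> [[[|k p] b] b']; first by exists k0.
  have [h|nv] := pselect (exists v, fvars (sub p) v /\
      asg (k :: p) b' v <> asg p b v).
    have [v [vp vN]] := h; exists (u (e p v)) => k' p' [<- <-] /= _ _ _.
    by exists v.
  (* If the assignments agreed on the free variables, that of [b'] would supply a witness on the
     block, making the existential formula true at [b]. *)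
  exists k0 => k' p' [<- <-] /= pE hb' hb; case: nv.
  apply: contrapT => nv; apply: hb; move: pE hb' nv => /=.
  case: (sub p) => // X phi _ /= hb' nv.
  exists (fun v => if pselect (X v) then asg (k :: p) b' v else asg p b v).
  split=> [v nX|]; first by case: pselect.
  apply: (holds_ext _).1 hb' => v vphi; case: pselect => // nX.
  by apply: contrapT => h; apply: nv; exists v.
exists rc, (fun p b => c (fail (p, b))), (fun q b b' => c (cl (q, b, b'))).
split.
- exact: c_inj.
- by move=> p b; exists (fail (p, b)).
- by move=> p b b'; exists (cl (p, b, b')).
- by move=> p b; rewrite holds_eta.
- by move=> k p b; have [h _] := recP (k :: p, b) k p erefl.
- by move=> k p b; have [_ h] := recP (k :: p, b) k p erefl.
- by move=> p b pC np; exists (fail (p, b)) => //; apply: failP.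
- move=> k p b b' pE hb' hb.
  have [v [vp vN vk]] := clP (k :: p, b, b') k p erefl pE hb' hb.
  by exists v; split=> //; rewrite -vk.
- by move=> s; rewrite holds_eta; apply: M0psi.
Qed.

End Expansion.
End Main.

(** * Assembling the equivalence *)

Lemma bounded_enumeration (U : ord) V (X : set V) (i : U) : emb X (below i) ->
  exists e : V -> U, (forall v, X v -> olt (e v) i) /\
    (forall v w, X v -> X w -> e v = e w -> v = w).
Proof.
move=> [f fi].
exists (fun v => if pselect (X v) is left h then sval (f (SigSub (mem_set h))) else i).
split=> [v Xv|v w Xv Xw]; first by case: pselect => // h; case: (f _).
case: pselect => // h; case: pselect => // h' /below_val_inj/fi.
by move=> /(congr1 val).
Qed.

(** [F_j] is a total function, so positions beyond the length get the default [m0]. *)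
Definition entry (U : ord) M (m0 : M) (x : seq_lt U M) (j : U) : M :=
  if pselect (olt j (tag x)) is left h then tagged x (exist _ j h) else m0.

Lemma entryE (U : ord) M (m0 : M) (i : U) (a : below i -> M) (j : below i) :
  entry m0 (existT _ i a) (sval j) = a j.
Proof.
rewrite /entry; case: pselect => [h|]; last by case: j.
by congr a; apply: below_val_inj.
Qed.

Theorem theorem1p11 (lam lamp kap : ord) (tau0 : vocab) (V : Type)
    (psi : formula tau0 V)
    (hlam : infinite_cardinal lam)
    (hlamp : is_successor_cardinal lam lamp)
    (hkap : infinite_cardinal kap)
    (hkap_le : [set: kap] #<= [set: lamp])
    (htau0 : [set: symbols tau0] #<= [set: lam])
    (hpsi : sentence_of_L lam kap psi) :
  exists (tau1 : vocab) (inc : vocab_incl tau0 tau1)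
    (F : Upsilon lam kap -> fsymb tau1 1) (P : Upsilon lam kap -> rsymb tau1 1)
    (T1 : set (fo tau1)) (Pstar : rsymb tau1 1) (c : lam -> fsymb tau1 0),
    [/\ [set: symbols tau1] #= [set: lam],
        injective F /\ (forall i, ~ range (@finc _ _ inc 1) (F i)),
        injective P /\ (forall i, ~ range (@rinc _ _ inc 1) (P i)),
        fo_theory T1 &
        forall M0 : structure tau0,
          (models M0 psi /\ [set: M0] #= [set: (seq_lt kap M0 + lam)%type])
          <->
          (exists M1 : structure tau1,
            [/\ is_expansion inc M0 M1,
                fo_models M1 T1,
                omits M1 (ptype Pstar c),
                partition [set: Upsilon lam kap]
                  (fun i => [set b : M1 | rint (P i) [tuple b]]) [set: M1] &
                forall (i : Upsilon lam kap) (a : below i -> M1),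
                  exists b : M1, rint (P i) [tuple b] /\
                    forall j : below i, fint (F (sval j)) [tuple b] = a j])].
Proof.
case: hpsi => psiL psi0.
have inf := emb_nat_lam hlam; have [nu _] := inf; pose k0 := nu 0.
have Ulam := emb_Upsilon kap hlam; have [u u_inj] := Ulam.
set U := Upsilon lam kap in u u_inj Ulam *.
have /choice[e eP] (p : seq lam) : exists e : V -> U,
    (exists i, forall v, fvars (subformula psi p) v -> olt (e v) i) /\
    (forall v w, fvars (subformula psi p) v -> fvars (subformula psi p) w ->
      e v = e w -> v = w).
  have [i /bounded_enumeration[e [ei einj]]] :=
    lt_kap_Upsilon hlamp hkap_le (in_L_fvars (in_L_subformula p psiL)).
  by exists e; split=> //; exists i.
have e_inj p := (eP p).2; have e_bound p := (eP p).1.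
exists (vocab1 lam U tau0), (vocab1_incl lam U tau0),
  (fun i => inr (Coord lam i)), (fun i => inr (Length lam i)),
  (theory1 psi u e), (inr (Index lam U)), (fun k => inr (Cst U k)).
split.
- exact: card_vocab1.
- by split=> [i j []|i [f _]].
- by split=> [i j []|i [f _]].
- exact: fo_theory_of_class.
move=> M0; split.
- move=> [M0psi cardM0].
  have lamM : emb lam M0.
    move: (cardM0); rewrite card_eq_le => /andP[_ /emb_cardP]; apply: emb_trans.
    by exists inr => x y [].
  have seqM := (card_M_iff hlam hlamp hkap hkap_le lamM).1 cardM0.
  have [m0] := univ_inh M0; have [c c_inj] := lamM.
  have [i0 _] := lt_kap_Upsilon hlamp hkap_le (finite_lt_kap hkap (n := 0)).
  have [//|f f_surj] := emb_surj_inv seqM.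
    by exists; exists i0 => _; exact: m0.
  (* Every element [b] codes [f b], and all sequences occur: surjectivity yields (beta), and the
     length of [f b] yields the partition. *)
  pose F (i : U) (b : M0) := entry m0 (f b) i.
  pose P (i : U) (b : M0) := tag (f b) = i.
  have codeP (i : U) (a : below i -> M0) :
      exists b, P i b /\ forall j, F (sval j) b = a j.
    have [b fb] := f_surj (existT _ i a); exists b; rewrite /P /F fb.
    by split=> // j; apply: entryE.
  have [|rec [fail [cl int]]] := @intended_expand lam U kap _ _ psi psiL k0 u e
    e_inj e_bound M0 m0 c F P c_inj _ M0psi.
    by move=> i a; have [b [_ bF]] := codeP i a; exists b.
  exists (expand psi e m0 c F P rec fail cl); split.
  + exact: is_expansion_expand.
  + exact: fo_models_class.
  + by apply/(omits_ptype _ k0) => b [k bk]; exists k.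
  + split.
    * by apply/seteqP; split=> // b _; exists (tag (f b)).
    * by move=> i j _ _ [b [<- <-]].
    * by move=> i _; have [b [Pb _]] := codeP i (fun=> m0); exists b.
  + exact: codeP.
- move=> [M [<- MT /(omits_ptype _ k0) Momit [_ disj _] Mcode]].
  have Mcode' (i : U) (a : below i -> M) :
      exists b, forall j, coord (sval j) b = a j.
    by have [b [_ bF]] := Mcode i a; exists b.
  split; first exact: (theory1_psi psiL k0 u_inj e_inj e_bound MT Momit Mcode').
  apply/(card_M_iff hlam hlamp hkap hkap_le).
    by exists (@cname _ _ _ M); apply: cname_inj MT.
  (* A code is chosen for each sequence; disjointness of the [P_i] recovers its length and the
     functions [F_j] recover its entries. *)
  pose b (x : seq_lt U M) := projT1 (cid (Mcode (tag x) (tagged x))).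
  have bP x : rint (inr (Length lam (tag x)) : rsymb (vocab1 lam U tau0) 1)
      [tuple b x] /\ forall j, coord (sval j) (b x) = tagged x j.
    by rewrite /b; case: cid.
  exists b => -[i a] [i' a'] bb'.
  have ii' : i = i'.
    apply: (disj i i') => //; exists (b (existT _ i a)).
    by split; [exact: (bP (existT _ i a)).1|rewrite bb'; exact: (bP (existT _ i' a')).1].
  subst i'; congr existT; apply/funext => j.
  have /= <- := (bP (existT _ i a)).2 j.
  by have /= <- := (bP (existT _ i a')).2 j; rewrite bb'.
Qed.
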